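(* $\mathbf{cov}(\mathcal{L}) \leq \text{\ss}$, where $\mathbf{cov}(\mathcal{L})$ is the covering number of the Lebesgue null ideal and $\text{\ss}$ is the subseries number.
   Context: $\mathbb{N}=\{1,2,3,\dots\}$. For $A\subseteq\mathbb{N}$, the subseries $\sum_{n\in A}a_n$ is summed in increasing order of the indices; if $A$ is finite it is a finite sum and counts as convergent. A series is conditionally convergent if it converges but not absolutely. The subseries number $\text{\ss}$ is the smallest cardinality of a family $\mathcal{A}$ of subsets of $\mathbb{N}$ such that for every conditionally convergent series $\sum_{n\in\mathbb{N}}a_n$ of real numbers there is $A\in\mathcal{A}$ such that $\sum_{n\in A}a_n$ diverges. The Lebesgue measure on the Cantor space $2^{\mathbb{N}}$ is the product measure in which each set $\{s\in 2^{\mathbb{N}}: s(n)=i\}$ ($n\in\mathbb{N}$, $i\in\{0,1\}$) has measure $1/2$. $\mathbf{cov}(\mathcal{L})$ is the smallest cardinality of a collection of Lebesgue-measure-zero subsets of $2^{\mathbb{N}}$ whose union is $2^{\mathbb{N}}$. *)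

(* Defs.v *)
From mathcomp Require Import all_boot all_order all_algebra.
From mathcomp Require Import all_classical all_reals all_analysis.
From mathcomp Require Import zify lra.

Set Implicit Arguments.
Unset Strict Implicit.
Unset Printing Implicit Defensive.

Import Order.TTheory GRing.Theory Num.Theory.
Import numFieldNormedType.Exports.

Local Open Scope classical_set_scope.
Local Open Scope ring_scope.
Local Open Scope card_scope.

(* A maximal set F of choice functions on P, no two of which agree on a member
   of P, exhausts some member of P, which then injects into all the others. *)
Lemma ex_least_card (T : Type) (P : set (set T)) : P !=set0 ->
  exists K, P K /\ forall L, P L -> K #<= L.
Proof.
move=> [K0 PK0].
have [[L PL L0]|nL0] := pselect (exists2 L, P L & L = set0).
  by exists L; split => // M _; rewrite L0 card_ge0.
have ne L : P L -> exists x, L x.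
  by move=> PL; apply/set0P/eqP => L0; apply: nL0; exists L.
pose ok (F : set (set T -> T)) :=
  (forall f L, F f -> P L -> L (f L)) /\
  (forall f g L, F f -> F g -> P L -> f L = g L -> f = g).
have okU (C : set (set (set T -> T))) : C `<=` ok -> total_on C subset ->
    ok (\bigcup_(X in C) X).
  move=> Cok Ctot; split.
    by move=> f L [X CX Xf] PL; exact: (Cok X CX).1 Xf PL.
  move=> f g L [X CX Xf] [Y CY Yg] PL fg.
  have [XY|YX] := Ctot _ _ CX CY.
    by exact: ((Cok _ CY).2 f g L (XY _ Xf) Yg PL fg).
  by exact: ((Cok _ CX).2 f g L Xf (YX _ Yg) PL fg).
have [F [[F1 F2] Fmax]] := Zorn_bigcup okU.
have [[K PK Kall]|nK] := pselect
    (exists2 K, P K & forall x, K x -> exists2 f, F f & f K = x).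
  exists K; split => // L PL.
  pose u x := if pselect (K x) is left Kx
    then (sval (cid2 (Kall x Kx))) L else x.
  have uE x : K x -> exists2 f, F f & f K = x /\ u x = f L.
    rewrite /u; case: pselect => // Kx _; case: cid2 => f Ff fK /=.
    by exists f.
  have uKL : {homo u : x / K x >-> L x}.
    by move=> x /uE[f Ff [_ ->]]; exact: F1 Ff PL.
  have uinj : {in K &, injective u}.
    move=> x y /set_mem/uE[f Ff [fx ->]] /set_mem/uE[g Fg [gy ->]] fg.
    by rewrite -fx -gy (F2 _ _ _ Ff Fg PL fg).
  have [v uv] := Pfun uKL; rewrite uv in uinj.
  by have [w _] := funPinj uinj; exact: (inj_card_le w).
have nx L : exists x, P L -> L x /\ forall f, F f -> f L <> x.
  have [PL|nPL] := pselect (P L); last by have [x _] := ne _ PK0; exists x.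
  apply: contrapT => H; apply: nK; exists L => // x Lx; apply: contrapT => Hx.
  by apply: H; exists x => _; split => // f Ff fx; apply: Hx; exists f.
pose h L := sval (cid (nx L)).
have hP L : P L -> L (h L) /\ forall f, F f -> f L <> h L.
  by rewrite /h; case: cid.
exfalso; apply: (Fmax (F `|` [set h])).
  split; first by left.
  by move=> /(_ h (or_intror erefl)) Fh; exact: (hP _ PK0).2 Fh erefl.
split.
  by move=> f L [Ff|->] PL; [exact: F1 Ff PL|exact: (hP _ PL).1].
move=> f g L [Ff|->] [Fg|->] PL => //; first exact: F2 Ff Fg PL.
  by move=> /((hP _ PL).2 _ Ff).
by move=> /esym/((hP _ PL).2 _ Fg).
Qed.

(* The least cardinality of a member of P, as a member of P realizing it;
   cardinals are compared with [#<=] (existence of an injection). *)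
Definition least_card (T : Type) (P : set (set T)) (P0 : P !=set0) : set T :=
  projT1 (cid (ex_least_card P0)).

Lemma least_cardP (T : Type) (P : set (set T)) (P0 : P !=set0) :
  P (least_card P0) /\ forall L, P L -> least_card P0 #<= L.
Proof. exact: projT2 (cid (ex_least_card P0)). Qed.

(* Positive integers are re-indexed by [nat] through n |-> n.-1. *)
Section subseries.
Variable R : realType.
Implicit Types (a : R ^nat) (A : set nat) (F : set (set nat)).

Definition conditionally_convergent a :=
  cvgn (series a) /\ ~ cvgn [normed series a].

(* The N-th term is the sum over the elements of A below N; up to repetitions
   this is the sequence of partial sums along the increasing enumeration of A,
   and it is eventually constant when A is finite. *)
Definition subseries a A : R ^nat :=
  fun N => \sum_(0 <= n < N | n \in A) a n.

Definition subseries_family F :=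
  forall a, conditionally_convergent a ->
  exists2 A, F A & ~ cvgn (subseries a A).

Lemma subseries_family_setT : subseries_family setT.
Proof.
move=> a [ca nca]; exists [set n | 0 <= a n] => // cp; apply: nca.
have -> : [normed series a]
    = (fun N => 2 * subseries a [set n | 0 <= a n] N - series a N).
  apply/funext => N; rewrite /subseries /series /= mulr_sumr big_mkcond /=.
  rewrite -sumrB; apply: eq_bigr => n _; case: ifPn.
    by move=> /set_mem /= an; rewrite ger0_norm //; lra.
  by rewrite notin_setE /= => /negP; rewrite -ltNge => an; rewrite ltr0_norm ?sub0r.
by apply: is_cvgB => //; apply: is_cvgMr.
Qed.

Definition subseries_number : set (set nat) :=
  least_card (ex_intro subseries_family _ subseries_family_setT).

End subseries.

Definition coordinate_sets : set (set cantor_space) :=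
  [set A | exists n i, A = [set s | s n = i]].

Definition cantor := g_sigma_algebraType coordinate_sets.

Section cantor_measure.
Variable R : realType.

(* The product of the uniform measures on {0,1}: the coordinates are
   independent and each set {s | s n = i} has measure 1/2. *)
Definition fair_product_measure (mu : {measure set cantor -> \bar R}) :=
  forall (J : seq nat) (t : nat -> bool), uniq J ->
    mu [set s | forall n, n \in J -> s n = t n] = ((2^-1) ^+ size J)%:E.

Lemma measurable_cylinder (J : seq nat) (t : nat -> bool) :
  measurable ([set s | forall n, n \in J -> s n = t n] : set cantor).
Proof.
rewrite (_ : mkset _ = \bigcap_(n in [set` J]) [set s : cantor | s n = t n]).
  apply: bigcap_measurableType => n _; apply: sub_sigma_algebra.
  by exists n, (t n).
by apply/seteqP; split => s /= sJ n nJ; exact: sJ.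
Qed.

(* Existence: push Lebesgue measure on [0, 1[ forward along binary digits. *)
Let digits (x : R) : cantor := fun n => odd (Num.truncn (2 ^+ n.+1 * x)).

Let truncn_double (y : R) : 0 <= y ->
  Num.truncn (2 * y) = (odd (Num.truncn (2 * y)) + (Num.truncn y).*2)%N.
Proof.
move=> y0; rewrite -[LHS]odd_double_half; congr (_ + _.*2)%N.
apply/esym/eqP; rewrite truncn_eq//.
have /andP[] := truncn_itv (mulr_ge0 (ler0n R 2) y0).
set k := Num.truncn _ => kl ku.
have kE : k%:R = (odd k)%:R + 2 * (k./2)%:R :> R.
  by rewrite -{1}(odd_double_half k) natrD -mul2n natrM.
have /andP[b0 b1] : 0 <= ((odd k)%:R : R) <= 1.
  by case: (odd k); rewrite /= ?lexx ?ler01.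
by move: ku kl; rewrite -!natr1 kE => ku kl; apply/andP; split; lra.
Qed.

Let measurable_digits : measurable_fun setT digits.
Proof.
refine (@measurability _ _ _ _ setT digits coordinate_sets erefl _).
move=> _ [_ [n [b ->]] <-]; rewrite setTI.
have c0 : 0 < 2 ^+ n.+1 :> R by rewrite exprn_gt0.
pose B k : set R := [set x | Num.truncn (2 ^+ n.+1 * x) = k].
rewrite [X in measurable X](_ : _ = \bigcup_(k in [set k | odd k = b]) B k); last first.
  apply/seteqP; split => [x xb|x [k kb xk]].
    by exists (Num.truncn (2 ^+ n.+1 * x)).
  by rewrite /= /digits xk.
apply: bigcup_measurable => k _.
have [->|k0] := posnP k.
  rewrite [X in measurable X](_ : _ = `]-oo, (2 ^+ n.+1)^-1[%classic) //.
  apply/seteqP; split => x /=; rewrite in_itv /= -[X in _ < X]mulr1 mulrC ltr_pdivlMr // mulrC => H.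
    by rewrite ltNge; apply/truncn0Pn.
  by apply/truncn0Pn; rewrite -ltNge.
rewrite [X in measurable X](_ : _ =
    `[k%:R / 2 ^+ n.+1, k.+1%:R / 2 ^+ n.+1[%classic) //.
apply/seteqP; split => x /=; rewrite in_itv /= ler_pdivrMr // ltr_pdivlMr // (mulrC x).
  move=> xk; have x0 : 0 <= 2 ^+ n.+1 * x.
    rewrite leNgt; apply/negP => /ltW x0.
    suff k00 : k = 0%N by rewrite k00 in k0.
    by rewrite -xk; apply/truncn0Pn; rewrite -ltNge (le_lt_trans x0).
  by rewrite -truncn_eq // xk.
by move=> H; exact: truncn_def.
Qed.

Let mu0 : {measure set (g_sigma_algebraType R.-ocitv.-measurable) -> \bar R} :=
  [the measure _ _ of mrestr (@lebesgue_measure R) (measurable_itv `[0, 1[)].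

Let mu_word n (t : nat -> bool) :
  mu0 (digits @^-1` [set s | forall i, (i < n)%N -> s i = t i]) =
  ((2^-1) ^+ n)%:E.
Proof.
have [k kn xk] : exists2 k, (k < 2 ^ n)%N & forall x : R, 0 <= x < 1 ->
    (forall i, (i < n)%N -> digits x i = t i) <->
    Num.truncn (2 ^+ n * x) = k.
  elim: n => [|n [k kn IH]].
    exists 0%N => // x /andP[x0 x1]; split => // _.
    by rewrite expr0 mul1r; apply/truncn0Pn; rewrite -ltNge.
  exists (t n + k.*2)%N; first by rewrite expnS; case: (t n); lia.
  move=> x x01; have [x0 _] := andP x01.
  have dE : Num.truncn (2 ^+ n.+1 * x) =
      (digits x n + (Num.truncn (2 ^+ n * x)).*2)%N.
    by rewrite /digits exprS -mulrA {1}truncn_double // mulr_ge0 // exprn_ge0.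
  rewrite dE; split.
    move=> H; rewrite H // (_ : Num.truncn _ = k) //; apply/(IH x x01) => i ilt.
    by apply: H; exact: ltnW.
  move=> H; have [dn tk] : digits x n = t n /\ Num.truncn (2 ^+ n * x) = k.
    move: H; move: (Num.truncn (2 ^+ n * x)) => m.
    by case: (digits x n); case: (t n) => /=; split; lia.
  move=> i; rewrite ltnS leq_eqVlt => /orP[/eqP->//|].
  by move: i; apply/(IH x x01).
have c0 : 0 < 2 ^+ n :> R by rewrite exprn_gt0.
rewrite /mu0 /= /mrestr (_ : _ `&` _ = `[k%:R / 2 ^+ n, k.+1%:R / 2 ^+ n[%classic).
  rewrite lebesgue_measure_itv /= lte_fin ltr_pM2r ?invr_gt0 // ltr_nat ltnSn.
  by rewrite -EFinD -mulrBl -natr1 addrAC subrr add0r mul1r exprVn.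
apply/seteqP; split => x /=; rewrite !in_itv /= ler_pdivrMr // ltr_pdivlMr // (mulrC x).
  move=> [H x01]; rewrite -truncn_eq; last first.
    by case/andP: x01 => x0 _; rewrite mulr_ge0 // ltW.
  by apply/eqP; apply/(xk x x01).
move=> H; have x01 : 0 <= x < 1.
  case/andP: H => H1 H2; apply/andP; split.
    by rewrite -(pmulr_rge0 _ c0) (le_trans _ H1).
  rewrite -(ltr_pM2l c0) mulr1 (lt_le_trans H2) //.
  by rewrite -natrX ler_nat.
by split => //; apply/(xk x x01); exact: truncn_def.
Qed.

Let digits_fair (J : seq nat) (t : nat -> bool) : uniq J ->
  mu0 (digits @^-1` [set s | forall n, n \in J -> s n = t n]) =
  ((2^-1) ^+ size J)%:E.
Proof.
pose N := (\max_(j <- J) j).+1.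
have JN : {subset J <= iota 0 N}.
  by move=> j jJ; rewrite mem_iota add0n /= ltnS; exact: leq_bigmax_seq.
move: N JN => N; move dE: (N - size J)%N => d.
elim: d J t dE => [|d IH] J t dE JN uJ.
  have sJ : (size J = N)%N.
    apply/eqP; rewrite eqn_leq -(size_iota 0 N) uniq_leq_size //=.
    by rewrite size_iota -subn_eq0 dE.
  have [_ JE] := uniq_min_size uJ JN (eq_leq (etrans (size_iota 0 N) (esym sJ))).
  rewrite sJ -(mu_word N t); congr (mu0 (_ @^-1` _)).
  apply/seteqP; split => s /= H i; last by move=> /JN; rewrite mem_iota; exact: H.
  by move=> iN; apply: H; rewrite JE mem_iota.
have [m mN mJ] : exists2 m, m \in iota 0 N & m \notin J.
  apply/allPn; apply/negP => /allP H.
  by have := uniq_leq_size (iota_uniq 0 N) H; rewrite size_iota -subn_eq0 dE.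
pose u b n := if n == m then b else t n.
pose C b : set cantor := [set s | forall n, n \in m :: J -> s n = u b n].
have muC b : mu0 (digits @^-1` C b) = ((2^-1) ^+ (size J).+1)%:E.
  apply: (IH (m :: J)) => /=; [by rewrite subnS dE| |by rewrite mJ].
  by move=> i; rewrite inE => /orP[/eqP->|/JN].
have CE : [set s : cantor | forall n, n \in J -> s n = t n] = C true `|` C false.
  apply/seteqP; split => s /=.
    move=> H; case sm : (s m); [left|right] => n; rewrite inE /u;
      by case: eqP => [->|_ /H].
  move=> H n nJ; have nm : (n == m) = false.
    by apply/eqP => nm; move: mJ; rewrite -nm nJ.
  by case: H => /(_ n); rewrite inE nJ orbT /u nm => ->.
have mC b : measurable (digits @^-1` C b).
  by rewrite -[X in measurable X]setTI; apply: measurable_digits => //; exact: measurable_cylinder.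
have C0 : digits @^-1` C true `&` digits @^-1` C false = set0.
  apply/seteqP; split => x //= -[/(_ m) + /(_ m)].
  by rewrite !inE eqxx /u eqxx => -> // /(_ isT).
rewrite CE preimage_setU.
transitivity (mu0 (digits @^-1` C true) + mu0 (digits @^-1` C false))%E.
  by rewrite (measureU mu0 (mC true) (mC false) C0).
by rewrite !muC -EFinD exprS; congr _%:E; lra.
Qed.

Lemma ex_fair_product_measure : exists mu, fair_product_measure mu.
Proof.
unshelve eexists (pushforward mu0 digits); first exact: measurable_digits.
by move=> J t uJ; exact: digits_fair.
Qed.

Lemma fair_product_measure_unique mu nu :
  fair_product_measure mu -> fair_product_measure nu ->
  forall A, measurable A -> mu A = nu A.
Proof.
move=> fmu fnu.
pose cyl (J : seq nat) (t : nat -> bool) : set cantor :=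
  [set s | forall n, n \in J -> s n = t n].
pose G : set (set cantor) :=
  [set A | A = set0 \/ exists J t, uniq J /\ A = cyl J t].
have GT : G setT.
  by right; exists [::], (fun=> true); split => //; apply/seteqP; split.
have Gm : G `<=` measurable.
  by move=> A [->//|[J [t [_ ->]]]]; exact: measurable_cylinder.
have mG : @measurable _ cantor `<=` <<s G >>.
  apply: smallest_sub; first exact: smallest_sigma_algebra.
  move=> A [n [b ->]]; apply: sub_sigma_algebra; right; exists [:: n], (fun=> b).
  split => //; apply/seteqP; split => s /=; first by move=> sn i; rewrite inE => /eqP ->.
  by apply; rewrite inE.
move=> A /mG; move: A; apply: (g_sigma_algebra_measure_unique G Gm (fun=> setT)) => //.
- by apply/seteqP; split => // s _; exists 0%N.
- move=> A B [->|[J [t [uJ ->]]]]; first by rewrite set0I; left.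
  case=> [->|[K [u [uK ->]]]]; first by rewrite setI0; left.
  have [tu|ntu] := pselect (forall n, n \in J -> n \in K -> t n = u n); last first.
    left; apply/seteqP; split => s //= -[sJ sK]; apply: ntu => n nJ nK.
    by rewrite -sJ // -sK.
  right; exists (undup (J ++ K)), (fun n => if n \in J then t n else u n).
  split; first exact: undup_uniq.
  apply/seteqP; split => s /=.
    move=> [sJ sK] n; rewrite mem_undup mem_cat; case: ifP => [nJ _|_ /=].
      exact: sJ.
    exact: sK.
  move=> H; split => n nJ; have := H n; rewrite mem_undup mem_cat nJ ?orbT => /(_ isT) ->//.
  by case: ifP => // nJ'; exact: tu.
- move=> A [->|[J [t [uJ ->]]]]; first by rewrite !measure0.
  by rewrite fmu // fnu.
- move=> k; rewrite (_ : setT = cyl [::] (fun=> true)); last first.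
    by apply/seteqP; split.
  by rewrite fmu //= ltry.
Qed.

Definition cantor_measure : {measure set cantor -> \bar R} :=
  projT1 (cid ex_fair_product_measure).

Lemma cantor_measureP : fair_product_measure cantor_measure.
Proof. exact: projT2 (cid ex_fair_product_measure). Qed.

(* [negligible] means contained in a measurable set of measure 0, i.e. of
   measure 0 for the completed measure. *)
Definition null_cover (C : set (set cantor)) :=
  (forall B, C B -> cantor_measure.-negligible B) /\
  \bigcup_(B in C) B = setT.

Lemma null_cover_singletons : null_cover (range set1).
Proof.
split; last first.
  by apply/seteqP; split => // s _; exists [set s] => //; exists s.
move=> _ [s _ <-].
pose C n : set cantor := [set r | forall i, i \in iota 0 n -> r i = s i].
exists (\bigcap_n C n); split; last 1 first.
- by move=> _ -> n _ i _.
- by apply: bigcapT_measurable => n; exact: measurable_cylinder.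
apply/eqP; rewrite eq_le measure_ge0 andbT; apply/lee_addgt0Pr => e e0.
rewrite add0e.
have [n ne] : exists n, (2^-1 : R) ^+ n <= e.
  have : (2^-1 : R) ^+ n @[n --> \oo] --> 0.
    by apply: cvg_expr; rewrite ger0_norm ?invr_ge0 // invf_lt1 // ltr1n.
  move=> /cvgrPdist_le /(_ _ e0) [n _ /(_ n (leqnn n))].
  by rewrite sub0r normrN ger0_norm ?exprn_ge0 // => H; exists n.
apply: (@le_trans _ _ (cantor_measure (C n))).
  apply: le_measure; rewrite ?inE.
  - by apply: bigcapT_measurable => k; exact: measurable_cylinder.
  - exact: measurable_cylinder.
  - by move=> r; exact.
by rewrite cantor_measureP ?iota_uniq // size_iota lee_fin.
Qed.

Definition cov_null : set (set cantor) :=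
  least_card (ex_intro null_cover _ null_cover_singletons).

End cantor_measure.

(* Main.v *)
(* Attach to each s in the Cantor space the series sum (-1)^(s n) c_n, where c is
   constant on each block [4^k, 4^(k+1)[ and sums to 1/(k+1) there; it never
   converges absolutely.  For a fixed A, the block sums of its subseries over A
   have second moment at most 4^-k, so they are almost surely absolutely
   summable, and inside a block the partial sums oscillate by at most 1/(k+1)
   whatever the signs.  Hence each subseries converges almost surely.
   If F is a subseries family, the null sets of those s for which the series or
   its subseries over A diverges, for A in F, therefore cover the Cantor space. *)
Require Import Defs.
From mathcomp Require Import all_boot all_order all_algebra.
From mathcomp Require Import all_classical all_reals all_analysis.
From mathcomp Require Import measurable_realfun.
From mathcomp Require Import zify ring lra.

Set Implicit Arguments.
Unset Strict Implicit.
Unset Printing Implicit Defensive.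

Import Order.TTheory GRing.Theory Num.Theory.
Import numFieldNormedType.Exports.

Local Open Scope classical_set_scope.
Local Open Scope ring_scope.
Local Open Scope card_scope.

(** * Convergence along the blocks [[4^k, 4^(k+1)[] *)

Section blocks.
Variable R : realType.
Implicit Types u : R ^nat.

Definition block_sum u k := \sum_(4 ^ k <= n < 4 ^ k.+1) u n.

(** The blocks start at index 1, so the term [u 0] has to be removed. *)
Lemma series_block_sum u K : series (block_sum u) K = series u (4 ^ K)%N - u 0%N.
Proof.
elim: K => [|K IH].
  by rewrite /series /= big_geq // expn0 big_nat1 subrr.
rewrite seriesSr IH /block_sum -sub_series_geq; last first.
  by rewrite leq_exp2l.
by ring.
Qed.

(** The factor [3 * 4 ^+ k] is the number of indices in block [k]. Index 0, which lies in no block,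
    gets the value 1/3 because [trunc_log 4 0 = 0]. *)
Definition block_coef : R ^nat :=
  fun n => let k := trunc_log 4 n in harmonic k / (3 * 4 ^+ k).

Lemma block_coef_ge0 n : 0 <= block_coef n.
Proof. by rewrite /block_coef divr_ge0 ?harmonic_ge0 // mulr_ge0 ?exprn_ge0. Qed.

Lemma block_coefE k n : (4 ^ k <= n < 4 ^ k.+1)%N ->
  block_coef n = harmonic k / (3 * 4 ^+ k).
Proof. by move=> kn; rewrite /block_coef (@trunc_log_eq 4 k n). Qed.

Lemma sum_block_const (x : R) k : \sum_(4 ^ k <= n < 4 ^ k.+1) x = (3 * 4 ^+ k) * x.
Proof.
rewrite sumr_const_nat -[x *+ _]mulr_natl; congr *%R.
by rewrite (_ : 4 ^ k.+1 - 4 ^ k = 3 * 4 ^ k)%N ?natrM ?natrX // expnS; lia.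
Qed.

Lemma block_sum_coef k : block_sum block_coef k = harmonic k.
Proof.
by rewrite /block_sum (eq_big_nat _ _ (@block_coefE k)) sum_block_const mulrC divfK.
Qed.

Lemma cvg_expn4 : (fun k => (4 ^ k)%N) @ \oo --> \oo.
Proof.
move=> A [N _ NA]; exists N => // k /= Nk; apply: NA => /=.
by apply: (leq_trans Nk); exact: ltnW (ltn_expl _ _).
Qed.

Lemma cvg_trunc_log4 : trunc_log 4 @ \oo --> \oo.
Proof.
move=> A [N _ NA]; exists (4 ^ N)%N => // k /= Nk; apply: NA => /=.
exact: trunc_log_max.
Qed.

(** Along the indices [4 ^ K] the partial sums are those of the harmonic series, up to a
    constant. *)
Lemma dvg_series_block_coef : ~ cvgn (series block_coef).
Proof.
move=> /cvg_ex[l cl]; apply: (@dvg_harmonic R); apply/cvg_ex.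
exists (l - block_coef 0%N).
have -> : series (@harmonic R) = (fun K => series block_coef (4 ^ K)%N - block_coef 0%N).
  apply/funext => K; rewrite -series_block_sum; congr (series _ _).
  by apply/funext => k; rewrite block_sum_coef.
by apply: cvgB; [exact: (cvg_comp _ _ cvg_expn4 cl)|exact: cvg_cst].
Qed.

(* The oscillation of the partial sums inside a block is at most the harmonic
   term of the block, so it suffices to follow them at block ends. *)
Lemma cvg_series_of_blocks u : (forall n, `|u n| <= block_coef n) ->
  cvgn (series (block_sum u)) -> cvgn (series u).
Proof.
move=> uc /cvg_ex[l cl].
have cT : series u (4 ^ trunc_log 4 N)%N @[N --> \oo] --> l + u 0%N.
  have -> : (fun N => series u (4 ^ trunc_log 4 N)%N) =
      (fun N => series (block_sum u) (trunc_log 4 N) + u 0%N).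
    by apply/funext => N; rewrite series_block_sum subrK.
  by apply: cvgD; [exact: (cvg_comp _ _ cvg_trunc_log4 cl)|exact: cvg_cst].
apply/cvg_ex; exists (l + u 0%N).
have c0 : series u N - series u (4 ^ trunc_log 4 N)%N @[N --> \oo] --> (0 : R).
  apply: norm_cvg0.
  apply: (@squeeze_cvgr _ _ _ _ (cst 0) (fun N => harmonic (trunc_log 4 N))).
  - near=> N; rewrite normr_ge0 /=.
    (* At [N = 0] the block start [4 ^ trunc_log 4 N = 1] would exceed [N]. *)
    have N0 : (0 < N)%N by near: N; exists 1%N.
    have pN : (4 ^ trunc_log 4 N <= N)%N by exact: trunc_logP.
    have Np : (N < 4 ^ (trunc_log 4 N).+1)%N by exact: trunc_log_ltn.
    rewrite sub_series_geq // -[leRHS]/(harmonic (trunc_log 4 N)) -block_sum_coef /block_sum.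
    rewrite (le_trans (ler_norm_sum _ _ _)) //.
    (* The block is cut at [N]: the first piece dominates the increment, the second is
       nonnegative. *)
    rewrite [leRHS](big_cat_nat pN (ltnW Np)) /= -[leLHS]addr0 lerD //.
      by apply: ler_sum => i _; exact: uc.
    by apply: sumr_ge0 => i _; exact: block_coef_ge0.
  - exact: cvg_cst.
  - exact: (cvg_comp _ _ cvg_trunc_log4 (@cvg_harmonic R)).
have -> : series u = (fun N => (series u N - series u (4 ^ trunc_log 4 N)%N) +
    series u (4 ^ trunc_log 4 N)%N) by apply/funext => N; rewrite subrK.
by rewrite -[l + _]add0r; exact: cvgD.
Unshelve. all: by end_near. Qed.

Lemma subseriesE (a : R ^nat) A :
  subseries a A = series (fun n => if n \in A then a n else 0).
Proof. by apply/funext => N; rewrite /subseries /series /= big_mkcond. Qed.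

Lemma subseries_setT (a : R ^nat) : subseries a setT = series a.
Proof.
by rewrite subseriesE; congr series; apply/funext => n; rewrite in_setT.
Qed.

End blocks.

(** By monotone convergence the sum [G] has integral at most the sum of the [v k], so it is finite
    almost everywhere. *)
Lemma ae_cvg_series d (T : measurableType d) (R : realType)
    (mu : {measure set T -> \bar R}) (g : nat -> T -> R) (v : R ^nat) :
  (forall k, measurable_fun setT (g k)) -> (forall k x, 0 <= g k x) ->
  (forall k, (\int[mu]_x (g k x)%:E <= (v k)%:E)%E) -> cvgn (series v) ->
  {ae mu, forall x, cvgn (series (g ^~ x))}.
Proof.
move=> mg g0 gv cv.
have mgE k : measurable_fun setT (EFin \o g k).
  by apply/measurable_EFinP; exact: mg.
pose G x := (\sum_(k <oo) (g k x)%:E)%E.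
have G0 x : (0 <= G x)%E by apply: nneseries_ge0 => k _ _; rewrite lee_fin.
have v0 k : 0 <= v k.
  rewrite -lee_fin; apply: le_trans (gv k).
  by apply: integral_ge0 => x _; rewrite lee_fin.
have iG : mu.-integrable setT G.
  apply/integrableP; split.
    apply: (@ge0_emeasurable_sum _ _ _ setT (fun k x => (g k x)%:E) xpredT).
      by move=> k x _ _; rewrite lee_fin.
    by move=> k _; exact: mgE.
  under eq_integral do rewrite gee0_abs //.
  rewrite integral_nneseries //; last by move=> k x _; rewrite lee_fin.
  apply: (@le_lt_trans _ _ (\sum_(k <oo) (v k)%:E)%E).
    apply: lee_nneseries => [k _ _|k _]; last exact: gv.
    by apply: integral_ge0 => x _; rewrite lee_fin.
  rewrite (_ : (fun n => _) = EFin \o series v); last first.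
    by apply/funext => n /=; rewrite /series /= sumEFin.
  by rewrite EFin_lim // ltry.
have := integrable_ae measurableT iG.
apply: filterS => x /(_ I) Gx.
apply: nondecreasing_is_cvgn; first by apply: nondecreasing_series => k _ _.
exists (fine (G x)) => _ [n _ <-]; rewrite -lee_fin fineK // /series /= -sumEFin.
by apply: nneseries_lim_ge => k _ _; rewrite lee_fin.
Qed.

(** * Random signs and almost sure convergence of subseries *)

Section random_signs.
Variable R : realType.
Local Notation mu := (@cantor_measure R).

Definition rsign n (s : cantor) : R := (-1) ^+ s n.

Lemma cantor_measureT : mu setT = 1%E.
Proof.
rewrite (_ : setT = [set s | forall n, n \in [::] -> s n = true]); last first.
  by apply/seteqP; split.
by rewrite cantor_measureP //= expr0.
Qed.

Lemma measurable_coord n b : measurable ([set s | s n = b] : set cantor).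
Proof. by apply: sub_sigma_algebra; exists n, b. Qed.

Lemma rsignE n s : rsign n s = 1 - 2 * \1_[set s : cantor | s n = true] s.
Proof.
rewrite /rsign indicE; case sn : (s n).
  by rewrite mem_set //= expr1; ring.
by rewrite memNset /= ?sn // expr0; ring.
Qed.

Lemma measurable_rsign n : measurable_fun setT (rsign n).
Proof.
rewrite (_ : rsign n = fun s => 1 - 2 * \1_[set s : cantor | s n = true] s); last first.
  by apply/funext => s; exact: rsignE.
apply: measurable_funB => //; apply: measurable_funM => //.
by apply: measurable_indic; exact: measurable_coord.
Qed.

Lemma normr_rsign n s : `|rsign n s| = 1.
Proof. by rewrite /rsign normrX normrN1 expr1n. Qed.

Lemma integrable_cantor_bounded (f : cantor -> R) c :
  measurable_fun setT f -> (forall s, `|f s| <= c) ->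
  mu.-integrable setT (EFin \o f).
Proof.
move=> mf fc; apply: measurable_bounded_integrable => //.
  by rewrite cantor_measureT ltry.
exists c; split; first exact: num_real.
by move=> M cM s _ /=; rewrite (le_trans (fc s)) // ltW.
Qed.

Lemma integrable_rsignM i j :
  mu.-integrable setT (fun s => (rsign i s * rsign j s)%:E).
Proof.
apply: (@integrable_cantor_bounded _ 1).
  by apply: measurable_funM; exact: measurable_rsign.
by move=> s; rewrite normrM !normr_rsign mulr1.
Qed.

(** Orthonormality of the Rademacher functions: for [i != j] the product is 1 where the two
    coordinates agree and -1 elsewhere, and both events have measure 1/2. *)
Lemma integral_rsignM i j :
  (\int[mu]_s (rsign i s * rsign j s)%:E = (i == j)%:R%:E)%E.
Proof.
have [->|ij] := eqVneq i j.
  rewrite (eq_integral (cst 1%E)) ?integral_cst // ?cantor_measureT ?mule1 //.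
  by move=> s _; rewrite -expr2 sqrr_sign.
(* Agreement of the coordinates [i] and [j] is the disjoint union of [C true] and [C false], each of
   measure 1/4. *)
pose C b : set cantor := [set s | forall n, n \in [:: i; j] -> s n = b].
have mC b : measurable (C b) := measurable_cylinder [:: i; j] (fun=> b).
have muC b : mu (C b) = (4^-1)%:E.
  by rewrite (@cantor_measureP R [:: i; j] (fun=> b)) ?[uniq _]/= ?inE ?ij //; congr _%:E; field.
have C0 : C true `&` C false = set0.
  by apply/seteqP; split => s //= -[/(_ i (mem_head _ _)) a /(_ i (mem_head _ _))]; rewrite a.
have mD : measurable (C true `|` C false) by exact: measurableU.
have muD : mu (C true `|` C false) = (2^-1)%:E.
  transitivity (mu (C true) + mu (C false))%E.
    by rewrite (measureU mu (mC true) (mC false) C0).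
  by rewrite !muC -EFinD; congr _%:E; field.
transitivity (\int[mu]_s ((2 * \1_(C true `|` C false) s)%:E - (1 : R)%:E))%E.
  apply: eq_integral => s _; rewrite -EFinB; congr _%:E.
  have [sC|sC] := pselect ((C true `|` C false) s).
    rewrite indicE mem_set //= /rsign.
    by case: sC => sC; rewrite (sC i) ?(sC j) ?inE ?eqxx ?orbT //=; ring.
  rewrite indicE memNset //= /rsign.
  case si : (s i); case sj : (s j); rewrite /= ?expr1 ?expr0; try ring.
    by case: sC; left => n; rewrite !inE => /orP[]/eqP ->.
  by case: sC; right => n; rewrite !inE => /orP[]/eqP ->.
rewrite integralB_EFin //; last 2 first.
- apply: (@integrable_cantor_bounded _ 2); first by apply: measurable_funM => //; exact: measurable_indic.
  by move=> s; rewrite indicE; case: (_ \in _); rewrite ger0_norm /=; lra.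
- by apply: (@integrable_cantor_bounded _ 1) => // s; rewrite normr1.
under eq_integral do rewrite EFinM.
rewrite ge0_integralZl //; last first.
  by apply/measurable_EFinP; exact: measurable_indic.
rewrite integral_indic // setIT muD integral_cst // cantor_measureT.
by rewrite -EFinM mule1 -EFinB; congr _%:E; rewrite divff ?subrr // pnatr_eq0.
Qed.

(** When the square is expanded, orthonormality kills the cross terms; since [J] has no repetition,
    only the diagonal remains. *)
Lemma integral_sqr_sum_rsign (J : seq nat) (x : R ^nat) : uniq J ->
  (\int[mu]_s ((\sum_(n <- J) x n * rsign n s) ^+ 2)%:E =
   (\sum_(n <- J) x n ^+ 2)%:E)%E.
Proof.
move=> uJ.
transitivity (\int[mu]_s
    (\sum_(i <- J) \sum_(j <- J) (x i * x j)%:E * (rsign i s * rsign j s)%:E))%E.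
  apply: eq_integral => s _; rewrite expr2 mulr_suml -sumEFin.
  apply: eq_bigr => i _; rewrite mulr_sumr -sumEFin; apply: eq_bigr => j _.
  by rewrite -EFinM; congr _%:E; ring.
have iM i j : mu.-integrable setT
    (fun s => (x i * x j)%:E * (rsign i s * rsign j s)%:E)%E.
  by apply: integrableZl => //; exact: integrable_rsignM.
rewrite integral_sum //; last by move=> i; apply: integrable_sum => // j _; exact: iM.
rewrite -sumEFin; apply: eq_big_seq => i iJ.
rewrite integral_sum // (bigD1_seq i) //= big1.
  rewrite adde0 integralZl //; last exact: integrable_rsignM.
  by rewrite integral_rsignM eqxx mule1 expr2.
move=> j ji; rewrite integralZl //; last exact: integrable_rsignM.
by rewrite integral_rsignM eq_sym (negbTE ji) mule0.
Qed.

Definition sign_series s : R ^nat := fun n => block_coef R n * rsign n s.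

Lemma negligible_dvg_subseries A :
  mu.-negligible [set s | ~ cvgn (subseries (sign_series s) A)].
Proof.
(* Zero coefficients outside [A] turn the subseries into a full series to which the block criterion
   applies. *)
pose x n : R := if n \in A then block_coef R n else 0.
pose b k s := \sum_(4 ^ k <= n < 4 ^ k.+1) x n * rsign n s.
have x0 n : 0 <= x n <= block_coef R n.
  by rewrite /x; case: ifP => _; rewrite ?lexx ?block_coef_ge0.
have mb k : measurable_fun setT (b k).
  apply: measurable_sum => n; apply: measurable_funM => //.
  exact: measurable_rsign.
(* With the weight [2 ^+ k] the expectations are still at most [2 ^- k], and AM-GM can later pass
   from squares to absolute values. *)
have : {ae mu, forall s, cvgn (series ((fun k s => 2 ^+ k * b k s ^+ 2) ^~ s))}.
  apply: (@ae_cvg_series _ _ _ _ _ (geometric 1 (2^-1))).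
  - by move=> k; apply: measurable_funM => //; exact: measurable_funX.
  - by move=> k s; rewrite mulr_ge0 ?sqr_ge0 // exprn_ge0.
  - move=> k; under eq_integral do rewrite EFinM.
    rewrite ge0_integralZl //; last 2 first.
    + by apply/measurable_EFinP; apply: measurable_funX.
    + by move=> s _; rewrite lee_fin sqr_ge0.
    rewrite integral_sqr_sum_rsign ?iota_uniq // -EFinM lee_fin /= mul1r.
    (* The crude bound [harmonic k <= 1] suffices: the sum is then [(3 * 4 ^+ k)^-1]. *)
    apply: (@le_trans _ _ (2 ^+ k * \sum_(4 ^ k <= n < 4 ^ k.+1) (3 * 4 ^+ k)^-1 ^+ 2)).
      rewrite ler_pM2l ?exprn_gt0 //; apply: ler_sum_nat => n kn.
      have /andP[xn0 xn] := x0 n; rewrite lerXn2r ?nnegrE //.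
      rewrite (le_trans xn) // (block_coefE _ kn) ler_piMl //.
      by rewrite /harmonic /= invf_le1 ?ler1n.
    rewrite sum_block_const expr2 mulVKf; last first.
      by rewrite mulf_neq0 ?expf_neq0 ?pnatr_eq0.
    rewrite ler_pdivrMr; last by rewrite mulr_gt0 // exprn_gt0.
    have -> : 2^-1 ^+ k * (3 * 4 ^+ k) = 3 * 2 ^+ k :> R.
      by rewrite mulrCA -exprMn (_ : 2^-1 * 4 = 2) //; field.
    by rewrite ler_peMl ?exprn_ge0 // ler1n.
  - by apply: is_cvg_geometric_series; rewrite ger0_norm ?invr_ge0 // invf_lt1 // ltr1n.
(* It remains to deduce convergence of the subseries at each [s] where the weighted squares are
   summable. *)
apply: negligibleS => s /= ncv cv; apply: ncv; rewrite subseriesE.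
set u := (u in series u).
have uE n : u n = x n * rsign n s.
  by rewrite /u /x /sign_series; case: ifP => // _; rewrite mul0r.
apply: cvg_series_of_blocks => [n|].
  have /andP[xn0 xn] := x0 n.
  by rewrite uE normrM normr_rsign mulr1 ger0_norm.
apply: normed_cvg.
apply: (@series_le_cvg _ _ (fun k => 2^-1 ^+ k + 2 ^+ k * b k s ^+ 2)).
- by move=> k /=.
- by move=> k; rewrite addr_ge0 // mulr_ge0 ?sqr_ge0.
- move=> k /=; rewrite /block_sum (eq_bigr (fun n => x n * rsign n s)) //.
  rewrite -/(b k s).
  (* AM-GM: [2 |y| <= 2 ^- k + 2 ^ k * y ^ 2] *)
  have k0 : 0 < 2 ^+ k :> R by rewrite exprn_gt0.
  have : 0 <= 2 ^- k * (2 ^+ k * `|b k s| - 1) ^+ 2.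
    by rewrite mulr_ge0 ?sqr_ge0 // invr_ge0 ltW.
  have -> : 2 ^- k * (2 ^+ k * `|b k s| - 1) ^+ 2 =
      2 ^- k + 2 ^+ k * `|b k s| ^+ 2 - 2 * `|b k s|.
    by field; rewrite gt_eqF.
  by rewrite real_normK ?num_real // exprVn => ?; have := normr_ge0 (b k s); lra.
- rewrite (_ : (fun k => _) = geometric 1 2^-1 + (fun k => 2 ^+ k * b k s ^+ 2)).
    rewrite seriesD; apply: is_cvgD => //.
    by apply: is_cvg_geometric_series; rewrite ger0_norm ?invr_ge0 // invf_lt1 // ltr1n.
  by apply/funext => k /=; rewrite -[RHS]/(_ + _) /= mul1r.
Qed.

End random_signs.

(** * From null sets to the inequality of cardinals *)

Section cov_null_le.
Variable R : realType.
Local Notation mu := (@cantor_measure R).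

Lemma conditionally_convergent_sign_series s :
  cvgn (series (sign_series R s)) -> conditionally_convergent (sign_series R s).
Proof.
move=> cs; split => //.
rewrite (_ : [normed series _] = series (block_coef R)); first exact: dvg_series_block_coef.
congr series; apply/funext => n.
by rewrite /= /sign_series normrM normr_rsign mulr1 ger0_norm ?block_coef_ge0.
Qed.

(** Otherwise the whole space, of measure 1, would be null. This yields a conditionally convergent
    series, hence a member in every subseries family. *)
Lemma ex_cvg_sign_series : exists s, cvgn (series (sign_series R s)).
Proof.
apply: contrapT => nex.
have /(negligibleP _ measurableT) : mu.-negligible setT.
  apply: negligibleS (negligible_dvg_subseries R setT) => s _ /=.
  by rewrite subseries_setT => cs; apply: nex; exists s.
by move=> /(etrans (esym (cantor_measureT R)))/eqP; rewrite onee_eq0.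
Qed.

End cov_null_le.

Theorem theorem11 (R : realType) : cov_null R #<= subseries_number R.
Proof.
have Ffam : subseries_family R (subseries_number R) := (least_cardP _).1.
(* A subseries family says nothing about divergent series; adding their null set to every [N A]
   keeps the cover indexed by the family. *)
pose N A : set cantor := [set s | ~ cvgn (series (sign_series R s))] `|`
  [set s | ~ cvgn (subseries (sign_series R s) A)].
(* By minimality of [cov_null], it is enough that the image of the family under [N] is a null
   cover. *)
apply: (card_le_trans _ (card_image_le N (subseries_number R))).
apply: (least_cardP _).2; split.
  move=> _ [A _ <-]; apply: negligibleU; last exact: negligible_dvg_subseries.
  apply: negligibleS (negligible_dvg_subseries R setT) => s /=.
  by rewrite subseries_setT.
apply/seteqP; split => // s _.
have [cs|ncs] := pselect (cvgn (series (sign_series R s))).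
  have [A FA dA] := Ffam _ (conditionally_convergent_sign_series cs).
  by exists (N A); [exists A|right].
(* If the series of [s] diverges, every [N A] contains [s]; some member [A] is obtained from another
   point [s0]. *)
have [s0 cs0] := ex_cvg_sign_series R.
have [A FA _] := Ffam _ (conditionally_convergent_sign_series cs0).
by exists (N A); [exists A|left].
Qed.
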